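(* Let $\varphi\colon\Gamma\to G$ be a homomorphism of groups. Then $\varphi$ is a normal map (i.e. $\varphi$ admits a normal structure) if and only if the map $p_\varphi\colon N(\varphi)\to G$ has a section, i.e. a group homomorphism $s\colon G\to N(\varphi)$ with $p_\varphi(s(g))=g$ for all $g\in G$, such that $s(\varphi(\gamma))=\widetilde\varphi(\gamma)$ for all $\gamma\in\Gamma$.
   Context: Notation: $h^g=g^{-1}hg$ in a group; automorphisms of $\Gamma$ act on the right, so in $\mathrm{Aut}(\Gamma)$ the product $\tau\sigma$ means first $\tau$, then $\sigma$; for $\gamma\in\Gamma$, $c_\gamma\in\mathrm{Aut}(\Gamma)$ is $\delta\mapsto\gamma^{-1}\delta\gamma$. A normal map (crossed module) is a group homomorphism $n\colon M\to G$ together with a right action of $G$ on $M$ by automorphisms, $(a,g)\mapsto a^g$ (the normal structure), such that (NM1) $n(a^g)=n(a)^g$ for all $a\in M$, $g\in G$; (NM2) $a^{n(b)}=a^b=b^{-1}ab$ for all $a,b\in M$. $N(\varphi)$ is the subgroup of $\mathrm{Aut}(\Gamma)\times N_G(\varphi(\Gamma))$ consisting of all compatible pairs $(\tau,g)$, i.e. those with $\varphi(\gamma)^g=\varphi(\tau(\gamma))$ for all $\gamma\in\Gamma$; $\widetilde\varphi\colon\Gamma\to N(\varphi)$ is $\gamma\mapsto(c_\gamma,\varphi(\gamma))$, and $p_\varphi\colon N(\varphi)\to G$ is $(\tau,g)\mapsto g$. *)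

(* Defs.v *)
From HB Require Import structures.
From mathcomp Require Import all_boot.
From mathcomp Require Import boolp classical_sets.

Set Implicit Arguments.
Unset Strict Implicit.
Unset Printing Implicit Defensive.

Local Open Scope group_scope.
Local Open Scope classical_set_scope.

Notation "{ 'grphom' G -> H }" := (UMagmaMorphism.type G%type H%type)
  (at level 0, G at level 98, H at level 99,
   format "{ 'grphom'  G  ->  H }") : type_scope.

(* Each [nact^~ g] is bijective, with inverse [nact^~ g^-1], by [nact1] and
   [nactM]; with [nact_morph] the action is thus by automorphisms of M. *)
Record normal_structure (M G : groupType) (n : {grphom M -> G}) := {
  nact : M -> G -> M;
  nact1 : forall a, nact a 1 = a;
  nactM : forall a g h, nact a (g * h) = nact (nact a g) h;
  nact_morph : forall g, {morph nact^~ g : a b / a * b};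
  NM1 : forall a g, n (nact a g) = n a ^ g;
  NM2 : forall a b, nact a (n b) = a ^ b
}.

Definition normal_map (M G : groupType) (n : {grphom M -> G}) : Prop :=
  inhabited (normal_structure n).

Section Aut.
Variable Gamma : groupType.

Definition is_aut (f : Gamma -> Gamma) : Prop :=
  bijective f /\ {morph f : x y / x * y}.

Record Aut := MkAut { aut_fun :> Gamma -> Gamma; _ : `[< is_aut aut_fun >] }.

HB.instance Definition _ := [isSub for aut_fun].
HB.instance Definition _ := [Choice of Aut by <:].

Implicit Types sigma tau : Aut.

Lemma aut_is_aut tau : is_aut tau.
Proof. by case: tau => f /= /asboolP. Qed.

Lemma aut_bij tau : bijective tau.
Proof. by case: (aut_is_aut tau). Qed.

Lemma autM tau : {morph tau : x y / x * y}.
Proof. by case: (aut_is_aut tau). Qed.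

Lemma aut_eqP sigma tau : sigma =1 tau -> sigma = tau.
Proof. by move=> /funext eq_st; apply: val_inj. Qed.

Fact aut_one_subproof : `[< is_aut (@id Gamma) >].
Proof. by apply/asboolP; split=> //; exists id. Qed.
Definition aut_one : Aut := MkAut aut_one_subproof.

(* Automorphisms act on the right: tau * sigma is tau followed by sigma. *)
Fact aut_mul_subproof tau sigma :
  `[< is_aut (fun gamma => sigma (tau gamma)) >].
Proof.
apply/asboolP; split; first exact: bij_comp (aut_bij sigma) (aut_bij tau).
by move=> x y; rewrite !autM.
Qed.
Definition aut_mul tau sigma : Aut := MkAut (aut_mul_subproof tau sigma).

Fact aut_inv_exists tau :
  exists f : Gamma -> Gamma, cancel tau f /\ cancel f tau.
Proof. by case: (aut_bij tau) => f tauK fK; exists f. Qed.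
Definition aut_inv_fun tau : Gamma -> Gamma :=
  projT1 (cid (aut_inv_exists tau)).

Lemma aut_funK tau : cancel tau (aut_inv_fun tau).
Proof. by rewrite /aut_inv_fun; case: cid => f []. Qed.

Lemma aut_inv_funK tau : cancel (aut_inv_fun tau) tau.
Proof. by rewrite /aut_inv_fun; case: cid => f []. Qed.

Fact aut_inv_subproof tau : `[< is_aut (aut_inv_fun tau) >].
Proof.
apply/asboolP; split.
  by exists tau; [exact: aut_inv_funK | exact: aut_funK].
move=> x y; apply: (canLR (aut_funK tau)).
by rewrite autM !aut_inv_funK.
Qed.
Definition aut_inv tau : Aut := MkAut (aut_inv_subproof tau).

Fact aut_mulA : associative aut_mul.
Proof. by move=> x y z; apply: aut_eqP. Qed.
Fact aut_mul1 : left_id aut_one aut_mul.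
Proof. by move=> x; apply: aut_eqP. Qed.
Fact aut_mulr1 : right_id aut_one aut_mul.
Proof. by move=> x; apply: aut_eqP. Qed.
Fact aut_mulV : left_inverse aut_one aut_inv aut_mul.
Proof. by move=> x; apply: aut_eqP => y /=; rewrite aut_inv_funK. Qed.
Fact aut_mulrV : right_inverse aut_one aut_inv aut_mul.
Proof. by move=> x; apply: aut_eqP => y /=; rewrite aut_funK. Qed.

HB.instance Definition _ :=
  isGroup.Build Aut aut_mulA aut_mul1 aut_mulr1 aut_mulV aut_mulrV.

Lemma aut1E (gamma : Gamma) : (1 : Aut) gamma = gamma.
Proof. by []. Qed.

Lemma autME tau sigma (gamma : Gamma) : (tau * sigma) gamma = sigma (tau gamma).
Proof. by []. Qed.

Fact inner_aut_subproof (gamma : Gamma) : `[< is_aut (conjg^~ gamma) >].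
Proof.
apply/asboolP; split; last by move=> x y; rewrite conjMg.
by exists (conjg^~ gamma^-1); [exact: conjgK | exact: conjgKV].
Qed.
Definition inner_aut (gamma : Gamma) : Aut := MkAut (inner_aut_subproof gamma).

End Aut.

Definition normalizer (G : groupType) (A : set G) : set G :=
  [set g | (conjg^~ g) @` A = A].

Section CompatiblePairs.
Variables (Gamma G : groupType) (phi : {grphom Gamma -> G}).

Definition compatible (u : Aut Gamma * G) : Prop :=
  normalizer (range phi) u.2 /\
  forall gamma : Gamma, phi gamma ^ u.2 = phi (u.1 gamma).

Definition compatible_pred : pred (Aut Gamma * G) :=
  fun u => `[< compatible u >].

Record Nphi := MkNphi {
  Nphi_pair : Aut Gamma * G; _ : compatible_pred Nphi_pair }.

HB.instance Definition _ := [isSub for Nphi_pair].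
HB.instance Definition _ := [Choice of Nphi by <:].

Fact compatible_group_closed : group_closed compatible_pred.
Proof.
split.
  apply/asboolP; split=> [|gamma] /=; last by rewrite conjg1.
  rewrite /normalizer /=; apply/seteqP.
  split=> [_ [x Ax <-]|x Ax]; first by rewrite conjg1.
  by exists x; rewrite // conjg1.
move=> u v /asboolP [Nu Cu] /asboolP [Nv Cv]; apply/asboolP.
have NVv : normalizer (range phi) v.2^-1.
  rewrite /normalizer /= -[in LHS]Nv; apply/seteqP.
  split=> [_ [_ [x Ax <-] <-]|x Ax]; first by rewrite conjgK.
  by exists (x ^ v.2); [exists x | rewrite conjgK].
split=> [|gamma] /=.
  rewrite /normalizer /= -[in RHS]NVv -[in RHS]Nu; apply/seteqP.
  split=> [_ [x Ax <-]|_ [_ [x Ax <-] <-]].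
    by exists (x ^ u.2); [exists x | rewrite conjgM].
  by exists x; rewrite // conjgM.
rewrite conjgM Cu; apply: (canLR (conjgK v.2)).
rewrite Cv; congr (phi _).
by rewrite -[RHS]/((u.1 * v.1^-1 * v.1) gamma) mulgVK.
Qed.

HB.instance Definition _ :=
  SubChoice_isSubGroup.Build _ compatible_pred Nphi compatible_group_closed.

Fact phi_tilde_subproof (gamma : Gamma) :
  compatible_pred (inner_aut gamma, phi gamma).
Proof.
apply/asboolP; split=> [|delta] /=; last by rewrite gmulfJ.
rewrite /normalizer /=; apply/seteqP.
split=> [_ [_ [x _ <-] <-]|_ [x _ <-]].
  by exists (x ^ gamma); rewrite // gmulfJ.
exists (phi (x ^ gamma^-1)); first by exists (x ^ gamma^-1).
by rewrite -gmulfJ conjgKV.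
Qed.
Definition phi_tilde (gamma : Gamma) : Nphi :=
  MkNphi (phi_tilde_subproof gamma).

Fact phi_tildeM : {morph phi_tilde : x y / x * y}.
Proof.
move=> x y; apply: val_inj; rewrite valM; congr (_, _); last exact: gmulfM.
by apply: aut_eqP => z /=; rewrite conjgM.
Qed.
Fact phi_tilde1 : phi_tilde 1 = 1.
Proof.
apply: val_inj; rewrite val1; congr (_, _); last exact: gmulf1.
by apply: aut_eqP => z /=; rewrite conjg1.
Qed.
HB.instance Definition _ :=
  isUMagmaMorphism.Build Gamma Nphi phi_tilde (phi_tilde1, phi_tildeM).

Definition p_phi (u : Nphi) : G := (Nphi_pair u).2.

Fact p_phiM : {morph p_phi : u v / u * v}.
Proof. by move=> u v; rewrite /p_phi -!/(val _) valM. Qed.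
Fact p_phi1 : p_phi 1 = 1.
Proof. by rewrite /p_phi -!/(val _) val1. Qed.
HB.instance Definition _ :=
  isUMagmaMorphism.Build Nphi G p_phi (p_phi1, p_phiM).

End CompatiblePairs.

(* Main.v *)
(* A normal structure is an action of G on Gamma by automorphisms, that is, a
   homomorphism from G to Aut Gamma.  (NM1) says that g, paired with its
   automorphism, is compatible, so that the homomorphism is the first component
   of a section of p_phi; (NM2) says that this section extends phi_tilde. *)
Require Import Defs.
From HB Require Import structures.
From mathcomp Require Import all_boot.
From mathcomp Require Import boolp classical_sets.

Local Open Scope group_scope.
Local Open Scope classical_set_scope.

Section SectionOfStructure.
Variables (Gamma G : groupType) (phi : {grphom Gamma -> G}).
Variable ns : normal_structure phi.

Lemma nactK (g : G) : cancel (nact ns ^~ g) (nact ns ^~ g^-1).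
Proof. by move=> a; rewrite -nactM mulgV nact1. Qed.

Lemma nactVK (g : G) : cancel (nact ns ^~ g^-1) (nact ns ^~ g).
Proof. by move=> a; rewrite -nactM mulVg nact1. Qed.

Fact nact_aut_subproof (g : G) : `[< is_aut (nact ns ^~ g) >].
Proof.
apply/asboolP; split; last exact: nact_morph.
by exists (nact ns ^~ g^-1); [exact: nactK | exact: nactVK].
Qed.

Definition nact_aut (g : G) : Aut Gamma := MkAut (nact_aut_subproof g).

Fact nact_section_subproof (g : G) : compatible_pred phi (nact_aut g, g).
Proof.
apply/asboolP; split=> [|gamma] /=; last by rewrite NM1.
rewrite /normalizer /=; apply/seteqP; split=> [_ [_ [x _ <-] <-]|_ [x _ <-]].
  by exists (nact ns x g); rewrite // NM1.
(* Normalizing is an equality of sets, so conjugation by [g] must also map the range of [phi] onto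
   itself. By (NM1), acting by [g^-1] on [x] yields a preimage of [phi x]. *)
exists (phi (nact ns x g^-1)); first by exists (nact ns x g^-1).
by rewrite -(NM1 ns) nactVK.
Qed.

Definition nact_section (g : G) : Nphi phi := MkNphi (nact_section_subproof g).

Fact nact_section1 : nact_section 1 = 1.
Proof.
apply: val_inj; rewrite val1; congr (_, _).
by apply: aut_eqP => a /=; rewrite nact1.
Qed.

Fact nact_sectionM : {morph nact_section : g h / g * h}.
Proof.
move=> g h; apply: val_inj; rewrite valM; congr (_, _).
(* The product in [Aut Gamma] applies its left factor first, which is the order of a right
   action. *)
by apply: aut_eqP => a /=; rewrite nactM.
Qed.

HB.instance Definition _ :=
  isUMagmaMorphism.Build G (Nphi phi) nact_section
    (nact_section1, nact_sectionM).

Lemma nact_section_phi (gamma : Gamma) :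
  nact_section (phi gamma) = phi_tilde phi gamma.
Proof.
apply: val_inj; congr (_, _).
by apply: aut_eqP => a /=; rewrite NM2.
Qed.

End SectionOfStructure.

Section StructureOfSection.
Variables (Gamma G : groupType) (phi : {grphom Gamma -> G}).
Variable s : {grphom G -> Nphi phi}.
Hypothesis sK : forall g : G, p_phi (s g) = g.
Hypothesis s_phi : forall gamma : Gamma, s (phi gamma) = phi_tilde phi gamma.

Definition section_act (a : Gamma) (g : G) : Gamma := (val (s g)).1 a.

Lemma section_normal_structure : normal_structure phi.
Proof.
exists section_act; rewrite /section_act.
- by move=> a; rewrite gmulf1 val1.
- by move=> a g h; rewrite gmulfM valM.
- by move=> g a b; rewrite autM.
(* Compatibility of the pair [s g] gives (NM1) with the second component of [s g] as conjugator;
   [sK] identifies that component with [g]. *)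
- move=> a g; have /asboolP[_ <-] := valP (s g).
  by rewrite -[in RHS](sK g).
(* The first component of [phi_tilde phi b] is conjugation by [b], so (NM2) remains by
   computation. *)
- by move=> a b; rewrite s_phi.
Qed.

End StructureOfSection.

Theorem lemma7p11 (Gamma G : groupType) (phi : {grphom Gamma -> G}) :
  normal_map phi <->
  exists s : {grphom G -> Nphi phi},
    (forall g : G, p_phi (s g) = g) /\
    (forall gamma : Gamma, s (phi gamma) = phi_tilde phi gamma).
Proof.
split=> [[ns]|[s [sK s_phi]]].
  by exists (nact_section _ _ _ ns); split=> // gamma; exact: nact_section_phi.
by constructor; exact: section_normal_structure sK s_phi.
Qed.
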